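(* Let $N\ge1$ be an integer. Let $\theta_0=\frac12$ be the true parameter and let $\Theta=\{\theta_0,\theta_1,\ldots,\theta_{2^N-1}\}$, where $\theta_k=\frac12+2^{-k-1}$ for $1\le k\le 2^N-1$. Let all complexities be equal, $K_w(\theta_0)=\cdots=K_w(\theta_{2^N-1})=N$. Then $$\sum_{n=1}^\infty\mathbf{E}\big(\theta_0-\theta^{x_{1:n}}\big)^2\;\ge\;\tfrac1{84}\big(2^N-5\big),$$ where (as $N\to\infty$) the right-hand side is of the same order, up to multiplicative constants, as $2^{K_w(\theta_0)}=2^N$.
   Context: Each $\theta\in\Theta$ has weight $w_\theta=2^{-K_w(\theta)}$. For $x\in\{0,1\}^n$, $n\ge1$, let $\mathbf 1(x)$ be its number of ones and $P(x|\theta)=\theta^{\mathbf 1(x)}(1-\theta)^{n-\mathbf 1(x)}$. The MDL estimator $\theta^x=\arg\max_{\theta\in\Theta}\{w_\theta P(x|\theta)\}$ is an element of $\Theta$ attaining the maximum (ties broken by any fixed rule depending only on $n$ and $\mathbf 1(x)/n$). $\mathbf{E}$ is expectation when $x_{1:n}=x_1\dots x_n$ consists of i.i.d. bits with $P(x_i=1)=\theta_0$. *)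

(* Defs.v *)
(* MathComp-Analysis, over an abstract [R : realType]. *)
From HB Require Import structures.
From mathcomp Require Import all_boot all_order all_algebra.
From mathcomp Require Import all_classical all_reals all_analysis.
Set Implicit Arguments.
Unset Strict Implicit.
Unset Printing Implicit Defensive.
Import Order.TTheory GRing.Theory Num.Theory.
Import numFieldNormedType.Exports.
Local Open Scope classical_set_scope.
Local Open Scope ring_scope.

Section mdl.
Context {R : realType}.
Implicit Types (Theta : set R) (Kw : R -> R) (x : seq bool).

(* A string of {0,1}^n is an [x : seq bool] with [size x = n]. *)
Definition ones x : nat := count id x.

Definition freq x : R := (ones x)%:R / (size x)%:R.

Definition likelihood x (theta : R) : R :=
  theta ^+ ones x * (1 - theta) ^+ (size x - ones x).

Definition weight Kw (theta : R) : R := 2 `^ (- Kw theta).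

Definition mdl_maximizers Theta Kw x : set R :=
  [set theta | Theta theta /\ forall eta, Theta eta ->
     weight Kw eta * likelihood x eta <= weight Kw theta * likelihood x theta].

(* [est x] is theta^x. The set of maximizers depends on [x] only through its
   length and its frequency of ones, so breaking ties by a rule that depends
   only on these two means that [est] itself factors through them. *)
Definition mdl_estimator Theta Kw (est : seq bool -> R) : Prop :=
  (forall x, (0 < size x)%N -> mdl_maximizers Theta Kw x (est x)) /\
  exists rule : nat -> R -> R,
    forall x, (0 < size x)%N -> est x = rule (size x) (freq x).

End mdl.

Section iid.
Context d (T : measurableType d) (R : realType) (P : probability T R).

Definition mutually_independent d' (T' : measurableType d')
    (X : nat -> {RV P >-> T'}) : Prop :=
  forall (J : seq nat) (B : nat -> set T'), uniq J ->
    (forall i, measurable (B i)) ->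
    P (\bigcap_(i in [set` J]) (X i @^-1` B i)) =
    (\prod_(i <- J) P (X i @^-1` B i))%E.

Definition iid_bits (X : nat -> {RV P >-> bool}) (theta : R) : Prop :=
  mutually_independent X /\ forall i, P (X i @^-1` [set true]) = theta%:E.

(* The bits are numbered from 0: [X i] is x_(i+1). *)
Definition prefix_bits (X : nat -> {RV P >-> bool}) (n : nat) (omega : T) :
    seq bool :=
  mkseq (fun i => X i omega) n.

End iid.

Definition theta_k (R : realType) (k : nat) : R :=
  if k == 0%N then 1 / 2 else 1 / 2 + 2 ^- k.+1.

Arguments theta_k : clear implicits.

Definition Theta_N (R : realType) (N : nat) : set R :=
  [set theta_k R k | k in [set k | (k < 2 ^ N)%N]].

Arguments Theta_N : clear implicits.

(* Main.v *)
Require Import Defs.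
From HB Require Import structures.
From mathcomp Require Import all_boot all_order all_algebra.
From mathcomp Require Import all_classical all_reals all_analysis.
From mathcomp Require Import measurable_realfun ring lra.
Set Implicit Arguments.
Unset Strict Implicit.
Unset Printing Implicit Defensive.
Import Order.TTheory GRing.Theory Num.Theory.
Import numFieldNormedType.Exports.
Local Open Scope classical_set_scope.
Local Open Scope ring_scope.

(** The error of the estimator dominates a quarter of the squared deviation of
the empirical frequency, and the latter has expectation 1 / (4 n), so that the
total error grows like a harmonic series.

In detail, put [K = 2 ^ N] and let [a = freq x - 1 / 2].  All weights are
equal, so the estimator maximizes the likelihood, which is strictly increasing
in the parameter up to the empirical frequency ([likelihood_lt]).  The
distances of the parameters to 1/2 are the powers 2 ^- 2, ..., 2 ^- K, each
twice the next.  As long as twice the current distance does not exceed [a], the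
next larger parameter is strictly more likely; hence the maximizer lies at
distance at least [a / 2] from 1/2 as soon as [a] reaches the smallest distance
2 ^- K ([mdl_error_ge_half_dev]).  Thus the squared error is at least
[(a ^+ 2 - 4 ^- K) / 4] whenever [a] is positive ([sqr_mdl_error_ge]).

A string and its complement have opposite deviations and are equally probable,
so restricting to positive [a] costs at most a factor 2, and the variance of
the frequency gives an expected error at time [n] of at least
[(1 / (4 n) - 4 ^- K) / 8] ([expected_error_ge]).  Summing up to [n = 4 ^ K]
costs only 1/8 in the correction terms, whereas the harmonic sum up to 4 ^ K is
at least [1 + K] ([harmonic_pow2_ge]).  The total is at least [(K - 3) / 32],
which exceeds [(K - 5) / 84] because [K >= 2]. *)

(** * The maximum-likelihood parameter follows the empirical frequency *)

Section deterministic.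
Context {R : realType}.
Implicit Types (theta eta : R) (x : seq bool) (Kw : R -> R).

(** Write [eta = theta * (1 + u)] and [1 - eta = (1 - theta) * (1 + v)].  Since
[1 + u < expR u], the ratio of the two sides is less than
[expR (s * u + m * v)], whose exponent has the sign of
[theta * (s + m) - s]. *)
Lemma bernoulli_pow_lt (s m : nat) eta theta : (0 < s)%N ->
  0 < eta -> eta < theta -> theta < 1 -> theta * (s + m)%:R <= s%:R ->
  eta ^+ s * (1 - eta) ^+ m < theta ^+ s * (1 - theta) ^+ m.
Proof.
move=> s0 eta0 lt_et th1 th_freq.
have th0 : 0 < theta by lra.
have co_th0 : 0 < 1 - theta by lra.
set u := (eta - theta) / theta; set v := (theta - eta) / (1 - theta).
have etaE : eta = theta * (1 + u) by rewrite /u; field; lra.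
have co_etaE : 1 - eta = (1 - theta) * (1 + v) by rewrite /v; field; lra.
have u0 : u != 0 by rewrite mulf_neq0 ?invr_eq0; lra.
have u_exp : eta < theta * expR u by rewrite {1}etaE ltr_pM2l ?expR_gt1Dx.
have v_exp : 1 - eta <= (1 - theta) * expR v.
  by rewrite {1}co_etaE ler_pM2l ?expR_ge1Dx.
have exp_le1 : expR (s%:R * u + m%:R * v) <= 1.
  rewrite -[leRHS]expR0 ler_expR.
  have -> : s%:R * u + m%:R * v =
      (theta - eta) / (theta * (1 - theta)) * (theta * (s + m)%:R - s%:R).
    by rewrite /u /v natrD; field; lra.
  by rewrite mulr_ge0_le0 ?subr_le0// divr_ge0 ?mulr_ge0//; lra.
apply: (@lt_le_trans _ _ ((theta * expR u) ^+ s * ((1 - theta) * expR v) ^+ m)).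
  apply: (@lt_le_trans _ _ ((theta * expR u) ^+ s * (1 - eta) ^+ m)).
    rewrite ltr_pM2r ?exprn_gt0//; last by lra.
    by rewrite ltrXn2r -?lt0n ?s0 ?(ltW eta0).
  rewrite ler_pM2l ?exprn_gt0 ?mulr_gt0 ?expR_gt0//.
  by rewrite lerXn2r ?nnegrE//; [lra|rewrite mulr_ge0 ?expR_ge0//; lra].
rewrite !exprMn -!expRM_natl mulrACA -expRD.
by rewrite ger_pMr ?mulr_gt0 ?exprn_gt0.
Qed.

Lemma likelihood_lt x eta theta : (0 < size x)%N ->
  0 < eta -> eta < theta -> theta < 1 -> theta <= freq x ->
  likelihood x eta < likelihood x theta.
Proof.
move=> x0 eta0 lt_et th1; rewrite /freq ler_pdivlMr ?ltr0n// => th_freq.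
have ones_le : (ones x <= size x)%N by exact: count_size.
apply: bernoulli_pow_lt; rewrite ?subnKC//.
rewrite -(ltr0n R); apply: lt_le_trans th_freq.
by rewrite mulr_gt0 ?ltr0n//; lra.
Qed.

(** Doubling the distance of a parameter to 1/2 yields the previous parameter;
if that one still lies below the frequency it is strictly more likely, so a
maximizer cannot be at distance [(freq x - 1 / 2) / 2] or less.  The parameter
1/4 away from 1/2 has no predecessor, but there the bound follows from
[freq x <= 1]. *)
Lemma mdl_error_ge_half_dev (N : nat) Kw x theta :
  (0 < N)%N -> (forall k : nat, (k < 2 ^ N)%N -> Kw (theta_k R k) = N%:R) ->
  (0 < size x)%N -> mdl_maximizers (Theta_N R N) Kw x theta ->
  2 ^- (2 ^ N) <= freq x - 1 / 2 :> R ->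
  (freq x - 1 / 2) / 2 <= theta - 1 / 2.
Proof.
move=> N0 KwE x0 [[k /= kN <-] maxk] dev_ge.
have freq_le1 : freq x <= 1 :> R.
  by rewrite /freq ler_pdivrMr ?ltr0n// mul1r ler_nat count_size.
have no_better j : (j < 2 ^ N)%N ->
    likelihood x (theta_k R j) <= likelihood x (theta_k R k).
  move=> jN; have := maxk (theta_k R j) (ex_intro2 _ _ j jN erefl).
  by rewrite /weight !KwE// ler_pM2l// powR_gt0.
have twoN : (1 < 2 ^ N)%N by rewrite -{1}(expn0 2) ltn_exp2l.
have step j : (0 < j)%N -> (j < 2 ^ N)%N -> theta_k R k < theta_k R j ->
    0 < theta_k R k -> freq x < theta_k R j.
  move=> j0 jN ltkj k0; rewrite ltNge; apply/negP => j_freq.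
  have := no_better j jN; rewrite leNgt => /negP; apply.
  apply: likelihood_lt => //.
  rewrite /theta_k; case: (j) j0 => // j' _.
  have : (2 : R) ^- j'.+2 <= 4^-1.
    have -> : 4 = 2 ^+ 2 :> R by ring.
    by rewrite lef_pV2 ?posrE ?exprn_gt0// ler_weXn2l// ler1n.
  by rewrite /=; lra.
case: k kN maxk no_better step => [|[|k]] kN maxk no_better step.
- (* 1/2 itself is beaten by the parameter closest to it *)
  have := step (2 ^ N).-1; rewrite /theta_k /=.
  have -> : ((2 ^ N).-1 == 0)%N = false by case: (2 ^ N)%N twoN => [|[]].
  rewrite prednK ?(ltnW twoN)// => /(_ _ (leqnn _)).
  have : (0 < (2 ^ N).-1)%N by rewrite -ltnS prednK ?(ltnW twoN).
  have : (0 : R) < 2 ^- (2 ^ N) by rewrite invr_gt0 exprn_gt0.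
  by move=> p0 pos /(_ pos); lra.
- by rewrite /theta_k /= expr2; lra.
- have := step k.+1 isT (ltnW kN); rewrite /theta_k /=.
  have p0 : (0 : R) < 2 ^- k.+3 by rewrite invr_gt0 exprn_gt0.
  have -> : (2 : R) ^- k.+2 = 2 * 2 ^- k.+3.
    by rewrite [in RHS]exprS; field; rewrite expf_neq0 ?pnatr_eq0.
  by lra.
Qed.

(** Subtracting [(2 ^- (2 ^ N)) ^+ 2] makes the left-hand side negative at the
small positive deviations for which the estimator may be 1/2, so that the
bound holds for every string. *)
Lemma sqr_mdl_error_ge (N : nat) Kw x theta :
  (0 < N)%N -> (forall k : nat, (k < 2 ^ N)%N -> Kw (theta_k R k) = N%:R) ->
  (0 < size x)%N -> mdl_maximizers (Theta_N R N) Kw x theta ->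
  ((freq x - 1 / 2) ^+ 2 - (2 ^- (2 ^ N)) ^+ 2) / 4 *+ (0 < freq x - 1 / 2 :> R) <=
  (theta_k R 0 - theta) ^+ 2.
Proof.
move=> N0 KwE x0 maxth.
have [dev0|_] := ltP 0 (freq x - 1 / 2 : R); last by rewrite mulr0n sqr_ge0.
rewrite mulr1n /theta_k /=.
have d0 : (0 : R) < 2 ^- (2 ^ N) by rewrite invr_gt0 exprn_gt0.
have [dev_ge|dev_lt] := leP (2 ^- (2 ^ N)) (freq x - 1 / 2 : R).
  have := mdl_error_ge_half_dev N0 KwE x0 maxth dev_ge.
  by move: dev0 d0; set a : R := freq x - 1 / 2; nra.
apply: (@le_trans _ _ 0); last exact: sqr_ge0.
by move: dev0 d0 dev_lt; set a : R := freq x - 1 / 2; nra.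
Qed.

End deterministic.

(** * Deviations of the frequency over uniformly distributed strings *)

Section uniform.
Context {R : realType}.

Lemma sum_tuple_cons n (F : seq bool -> R) :
  \sum_(t : n.+1.-tuple bool) F t =
  \sum_(b : bool) \sum_(t : n.-tuple bool) F (b :: t).
Proof.
rewrite pair_big /=.
rewrite (reindex (fun p : bool * n.-tuple bool => [tuple of p.1 :: p.2])) //=.
exists (fun t : n.+1.-tuple bool => (thead t, [tuple of behead t])).
  by case=> b t _; congr pair; apply: val_inj.
by move=> t _; rewrite -tuple_eta.
Qed.

(** The second moment of a simple random walk started at [c].  An arbitrary
starting point lets the induction absorb the first step, without a separate
computation of the mean. *)
Lemma sum_sqr_walk n (c : R) :
  \sum_(t : n.-tuple bool) (c + (2 * (ones t)%:R - n%:R)) ^+ 2 =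
  2 ^+ n * (n%:R + c ^+ 2).
Proof.
elim: n c => [|n IHn] c.
  rewrite (big_pred1 [tuple]) => [|t]; last by apply/esym/eqP; exact: tuple0.
  by rewrite /ones /= expr0; ring.
rewrite (sum_tuple_cons n (fun t => (c + (2 * (ones t)%:R - n.+1%:R)) ^+ 2)).
rewrite big_bool /=.
rewrite (eq_bigr (fun t : n.-tuple bool =>
  ((c + 1) + (2 * (ones t)%:R - n%:R)) ^+ 2)); last first.
  by move=> t _; rewrite /ones /= natrD -(addn1 n) natrD; congr (_ ^+ 2); ring.
rewrite IHn (eq_bigr (fun t : n.-tuple bool =>
  ((c - 1) + (2 * (ones t)%:R - n%:R)) ^+ 2)); last first.
  by move=> t _; rewrite /ones /= add0n -(addn1 n) natrD; congr (_ ^+ 2); ring.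
by rewrite IHn -(addn1 n) natrD exprD; ring.
Qed.

Lemma sum_sqr_freq n : (0 < n)%N ->
  \sum_(t : n.-tuple bool) (freq t - 1 / 2 : R) ^+ 2 = 2 ^+ n / (4 * n%:R).
Proof.
move=> n0; have nR : n%:R != 0 :> R by rewrite pnatr_eq0 -lt0n.
rewrite (eq_bigr (fun t : n.-tuple bool =>
  (0 + (2 * (ones t)%:R - n%:R)) ^+ 2 * (2 * n%:R) ^- 2 :> R)); last first.
  by move=> t _; rewrite /freq size_tuple; field.
by rewrite -mulr_suml sum_sqr_walk; field.
Qed.

Lemma freq_map_negb x : (0 < size x)%N ->
  freq (map negb x) - 1 / 2 = - (freq x - 1 / 2 : R).
Proof.
move=> x0; have sR : (size x)%:R != 0 :> R by rewrite pnatr_eq0 -lt0n.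
have /(congr1 (fun k => k%:R : R)) := count_predC id x.
rewrite /freq /ones size_map count_map /= natrD => sumE.
have -> : (count (preim negb id) x)%:R = (size x)%:R - (count id x)%:R :> R.
  by rewrite -sumE addrC addKr.
by field.
Qed.

Lemma sum_dev_negb n (F : R -> R) : (0 < n)%N ->
  \sum_(t : n.-tuple bool) F (- (freq t - 1 / 2)) =
  \sum_(t : n.-tuple bool) F (freq t - 1 / 2).
Proof.
move=> n0; rewrite [RHS](reindex_inj (h := map_tuple negb)) /=.
  by apply: eq_bigr => t _; rewrite freq_map_negb ?size_tuple.
move=> t u /(congr1 val) /= tu; apply: val_inj.
by apply: inj_map tu; exact: negb_inj.
Qed.

(** The deviations of a string and of its complement are opposite, hence the sum
over positive deviations is half of the sum over nonzero ones; the zero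
deviations only contribute [- d ^+ 2]. *)
Lemma sum_pos_dev_ge n (d : R) : (0 < n)%N ->
  2 ^+ n * (1 / (4 * n%:R) - d ^+ 2) / 2 <=
  \sum_(t : n.-tuple bool)
     ((freq t - 1 / 2) ^+ 2 - d ^+ 2) *+ (0 < freq t - 1 / 2 :> R).
Proof.
move=> n0; set F := fun a : R => (a ^+ 2 - d ^+ 2) *+ (0 < a :> R).
have FF a : a ^+ 2 - d ^+ 2 <= F a + F (- a).
  rewrite /F oppr_gt0 sqrrN.
  by case: (ltgtP a 0) => [a0|a0|->]; rewrite ?mulr0n ?mulr1n ?addr0 ?add0r//
    expr0n /= sub0r oppr_le0 sqr_ge0.
have : \sum_(t : n.-tuple bool) ((freq t - 1 / 2 : R) ^+ 2 - d ^+ 2) <=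
    \sum_(t : n.-tuple bool) (F (freq t - 1 / 2) + F (- (freq t - 1 / 2))).
  by apply: ler_sum => t _; exact: FF.
rewrite sumrB [X in _ <= X]big_split /= (sum_dev_negb F)// sum_sqr_freq// sumr_const.
rewrite card_tuple card_bool -[_ *+ (2 ^ n)%N]mulr_natl natrX.
rewrite -[X in _ -> _ <= X]/(\sum_(t : n.-tuple bool) F (freq t - 1 / 2)).
lra.
Qed.

End uniform.

(** * Growth of the bound *)

(** Each dyadic block of the harmonic series contributes at least 1/2. *)
Lemma harmonic_pow2_ge (R : realType) m :
  1 + m%:R / 2 <= \sum_(1 <= n < (2 ^ m).+1) (n%:R)^-1 :> R.
Proof.
elim: m => [|m IHm]; first by rewrite big_nat1 mul0r addr0 invr1.
have le2 : (2 ^ m <= 2 ^ m.+1)%N by rewrite leq_exp2l.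
rewrite (big_cat_nat (n := (2 ^ m).+1))//=.
have : 1 / 2 <= \sum_((2 ^ m).+1 <= n < (2 ^ m.+1).+1) (n%:R)^-1 :> R.
  apply: (@le_trans _ _
    (\sum_((2 ^ m).+1 <= n < (2 ^ m.+1).+1) ((2 ^ m.+1)%:R)^-1 : R)).
    rewrite sumr_const_nat subSS expnS mul2n -addnn addnK -mulr_natl natrD.
    have : (2 ^ m)%:R != 0 :> R by rewrite pnatr_eq0 expn_eq0.
    by move=> q0; rewrite le_eqVlt; apply/orP; left; apply/eqP; field.
  apply: ler_sum_nat => n /andP[n0 nM].
  by rewrite lef_pV2 ?posrE ?ltr0n ?expn_gt0 ?ler_nat// (leq_ltn_trans _ n0).
by rewrite -(addn1 m) natrD; lra.
Qed.

Lemma bigTheta_pow2 (R : realType) :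
  (fun N : nat => 1 / 84 * (2 ^+ N - 5) : R) \is 'Theta_\oo (fun N : nat => 2 ^+ N : R).
Proof.
apply/asboolP; exists (1 / 168, 1 / 84); first by apply/andP; split => /=; lra.
near=> N => /=.
have : (16 : R) <= 2 ^+ N.
  have -> : 16 = 2 ^+ 4 :> R by ring.
  by rewrite ler_weXn2l ?ler1n//; near: N; exact: nbhs_infty_ge.
by move=> N16; rewrite !ger0_norm; lra.
Unshelve. all: by end_near. Qed.

(** * Law of the observed prefix *)

Section prefix_law.
Context d (T : measurableType d) (R : realType) (P : probability T R).
Context (X : nat -> {RV P >-> bool}) (fair : iid_bits X (theta_k R 0)).

Lemma fair_bit i b : P (X i @^-1` [set b]) = (1 / 2)%:E.
Proof.
have [_ /(_ i)] := fair; rewrite /theta_k /= => Xtrue.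
case: b => //.
have -> : X i @^-1` [set false] = ~` (X i @^-1` [set true]).
  by apply/seteqP; split => w /=; case: (X i w).
rewrite probability_setC ?Xtrue; first by rewrite -EFinB; congr EFin; lra.
exact: measurable_funPTI.
Qed.

(** Expressing the event that the prefix is [t] as an intersection of events on
single bits is what makes both its measurability and mutual independence
available. *)
Lemma prefix_eventE n (t : n.-tuple bool) :
  [set w | prefix_bits X n w = t] =
  \bigcap_(i in [set` iota 0 n]) (X i @^-1` [set nth false t i]).
Proof.
apply/seteqP; split => w /=.
  move=> <- i /=; rewrite mem_iota /= add0n => i_n.
  by rewrite /prefix_bits nth_mkseq.
move=> Xt; apply: (@eq_from_nth _ false); first by rewrite size_mkseq size_tuple.
move=> i; rewrite size_mkseq => i_n; rewrite nth_mkseq//.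
by apply: Xt; rewrite /= mem_iota.
Qed.

Lemma measurable_prefix_event n (t : n.-tuple bool) :
  measurable [set w | prefix_bits X n w = t].
Proof.
rewrite prefix_eventE; apply: fin_bigcap_measurable => [|i _].
  exact: finite_seq.
exact: measurable_funPTI.
Qed.

Lemma prob_prefix n (t : n.-tuple bool) :
  P [set w | prefix_bits X n w = t] = (2 ^- n)%:E.
Proof.
rewrite prefix_eventE; have [indep _] := fair.
rewrite (indep _ (fun i => [set nth false t i])) ?iota_uniq//.
under eq_bigr do rewrite fair_bit.
by rewrite prodEFin big_const_seq count_predT size_iota iter_mulr_1 mul1r exprVn.
Qed.

Lemma expectation_prefix n (f : seq bool -> R) : (forall x, 0 <= f x) ->
  'E_P[(fun w => f (prefix_bits X n w))]%E =
  ((\sum_(t : n.-tuple bool) f t) / 2 ^+ n)%:E.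
Proof.
move=> f0; rewrite unlock.
pose A (t : n.-tuple bool) := [set w | prefix_bits X n w = t].
have fE w : (f (prefix_bits X n w))%:E =
    (\sum_(t : n.-tuple bool) (f t)%:E * (\1_(A t) w)%:E)%E.
  rewrite (bigD1 [tuple of prefix_bits X n w])//= big1 ?adde0.
    by rewrite indicE mem_set ?mule1.
  move=> t tw; rewrite indicE memNset ?mule0// => /= wt.
  by move/eqP: tw; apply; apply: val_inj.
under eq_integral do rewrite fE.
have mA t : measurable_fun setT (EFin \o (\1_(A t) : T -> R)).
  by apply/measurable_EFinP/measurable_indic; exact: measurable_prefix_event.
rewrite ge0_integral_sum//=; first last.
- by move=> t w _; rewrite mule_ge0 ?lee_fin.
- by move=> t; apply: measurable_funeM; exact: mA.
rewrite mulr_suml -sumEFin; apply: eq_bigr => t _.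
rewrite (ge0_integralZl_EFin _ _ _ (mA t) (f0 t))//; last first.
  by move=> w _; rewrite lee_fin.
have PA : P (A t) = (2 ^- n)%:E := prob_prefix t.
have mAt : measurable (A t) := measurable_prefix_event t.
by rewrite integral_indic// setIT EFinM; congr (_ * _)%E; exact: PA.
Qed.

End prefix_law.

(** * The cumulative error *)

Lemma expected_error_ge (R : realType) (N : nat) (Kw : R -> R)
    (est : seq bool -> R) d (T : measurableType d) (P : probability T R)
    (X : nat -> {RV P >-> bool}) n :
  (0 < N)%N -> (forall k : nat, (k < 2 ^ N)%N -> Kw (theta_k R k) = N%:R) ->
  mdl_estimator (Theta_N R N) Kw est -> iid_bits X (theta_k R 0) ->
  (0 < n)%N ->
  ((1 / 8 * (1 / (4 * n%:R) - (2 ^- (2 ^ N)) ^+ 2))%:E <=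
   'E_P[(fun w => (theta_k R 0 - est (prefix_bits X n w)) ^+ 2)%R])%E.
Proof.
move=> N0 KwE [maxest _] fair n0.
rewrite (expectation_prefix fair n (f := fun x => (theta_k R 0 - est x) ^+ 2)).
  rewrite lee_fin ler_pdivlMr ?exprn_gt0//.
  have := @sum_pos_dev_ge R n (2 ^- (2 ^ N)) n0.
  set S := \sum_(t : _) _ => S_ge.
  (* 1/8 is 1/4 from the squared error times 1/2 from the symmetry *)
  apply: (@le_trans _ _ (S / 4)); first by lra.
  rewrite mulr_suml; apply: ler_sum => t _; rewrite mulrnAl.
  have xt : (0 < size t)%N by rewrite size_tuple.
  exact: sqr_mdl_error_ge N0 KwE xt (maxest _ xt).
by move=> x; exact: sqr_ge0.
Qed.

Theorem proposition5 (R : realType) :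
  (forall (N : nat) (Kw : R -> R) (est : seq bool -> R)
      (d : measure_display) (T : measurableType d) (P : probability T R)
      (X : nat -> {RV P >-> bool}),
    (1 <= N)%N ->
    (forall k : nat, (k < 2 ^ N)%N -> Kw (theta_k R k) = N%:R) ->
    mdl_estimator (Theta_N R N) Kw est ->
    iid_bits X (theta_k R 0) ->
    ((1 / 84 * (2 ^+ N - 5))%:E <=
       \sum_(1 <= n <oo)
         'E_P[(fun omega => (theta_k R 0 - est (prefix_bits X n omega)) ^+ 2)%R])%E
    /\ 2 `^ Kw (theta_k R 0) = 2 ^+ N)
  /\ (fun N : nat => 1 / 84 * (2 ^+ N - 5) : R) \is 'Theta_\oo (fun N : nat => 2 ^+ N : R).
Proof.
split; last exact: bigTheta_pow2.
move=> N Kw est d T P X N0 KwE est_mdl fair; split; last first.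
  by rewrite KwE ?expn_gt0// powR_mulrn.
set K := (2 ^ N)%N.
have KE : 2 ^+ N = K%:R :> R by rewrite /K natrX.
(* up to this time the corrections [(2 ^- K) ^+ 2] sum to 1 *)
set M := (2 ^ (2 * K))%N.
have ME : (2 ^- K) ^+ 2 = M%:R^-1 :> R.
  by rewrite /M natrX mulnC exprM exprVn.
apply: le_trans (nneseries_lim_ge M.+1 _); last first.
  by move=> n _ _; apply: expectation_ge0 => w; exact: sqr_ge0.
apply: (@le_trans _ _ (\sum_(1 <= n < M.+1)
    (1 / 8 * (1 / (4 * n%:R) - (2 ^- K) ^+ 2))%:E)%E); last first.
  rewrite big_nat_cond [leRHS]big_nat_cond; apply: lee_sum => n.
  by rewrite andbT => /andP[n0 _]; exact: expected_error_ge N0 KwE est_mdl fair n0.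
rewrite sumEFin lee_fin -mulr_sumr sumrB sumr_const_nat subSS subn0 ME.
have -> : M%:R^-1 *+ M = 1 :> R.
  by rewrite -[LHS]mulr_natr mulVf// pnatr_eq0 -lt0n expn_gt0.
have -> : \sum_(1 <= n < M.+1) 1 / (4 * n%:R) =
    (\sum_(1 <= n < M.+1) n%:R^-1) / 4 :> R.
  by rewrite mulr_suml; apply: eq_bigr => n _; rewrite invfM mul1r mulrC.
have := harmonic_pow2_ge R (2 * K); rewrite -/M natrM KE.
have : (2 : R) <= K%:R.
  by rewrite (ler_nat _ 2) /K -{1}(expn1 2) leq_exp2l.
by lra.
Qed.
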